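(* Let $d\leq n$ be growing parameters satisfying $d=\omega(\log n)$. There is a $\Theta(dn)$-variate, degree-$\Theta(d)$ set-multilinear polynomial $G_{n,d}$ in $\mathsf{VBP}$ such that $G_{n,d}$ cannot be computed by a $\sum\mathsf{smABP}$ of total-width $\mathrm{poly}(n)$.
   Context: A polynomial is set-multilinear with respect to a partition $(X_1,\ldots,X_m)$ of its variables if every monomial contains exactly one variable from each $X_i$. Given such a partition, a set-multilinear algebraic branching program (ABP) of depth $m$ is ordered with respect to a permutation $\sigma\in S_m$ if it is a layered directed acyclic graph with a start node (layer $0$) and an end node (layer $m$), all edges going from layer $\ell-1$ to layer $\ell$, and every edge from layer $\ell-1$ to layer $\ell$ labelled by a linear form in the variables of $X_{\sigma(\ell)}$; it computes the sum over all start-to-end paths of the product of the edge labels. Its width is the maximum number of nodes in a layer. A $\sum\mathsf{smABP}$ computing a polynomial $P$ that is set-multilinear with respect to the partition is an expression $\sum_{i=1}^t A_i=P$ where each $A_i$ is a set-multilinear ABP ordered with respect to some (possibly different) permutation $\sigma_i$; its total-width is the sum of the widths of the $A_i$. $\mathsf{VBP}$ is the class of polynomial families of polynomially bounded degree computable by polynomial-size algebraic branching programs. ''Cannot be computed by a $\sum\mathsf{smABP}$ of total-width $\mathrm{poly}(n)$'' means the minimal total-width of such a representation is not bounded by any polynomial in $n$. *)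

(* Defs.v *)
From HB Require Import structures.
From mathcomp Require Import all_boot all_order all_algebra all_fingroup.
From mathcomp Require Import mpoly.
Set Implicit Arguments. Unset Strict Implicit. Unset Printing Implicit Defensive.
Import Order.TTheory GRing.Theory.
Local Open Scope ring_scope.

(* A layered ABP of depth L is given by a width function w (w l = number of  *)
(* nodes in layer l, l = 0..L; start layer 0 and end layer L have one node,  *)
(* node 0) and an edge-label function lab : l -> i -> j -> label of the edge *)
(* from node i of layer l-1 to node j of layer l (label 0 = no edge).        *)
(* abp_vec w lab l j = sum over all paths from the start node to node j of   *)
(* layer l of the product of the edge labels.                                *)
Fixpoint abp_vec (R : comNzRingType) (w : nat -> nat)
    (lab : nat -> nat -> nat -> R) (l : nat) : nat -> R :=
  match l with
  | 0 => fun j => if j == 0%N then 1 else 0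
  | l'.+1 => fun j => \sum_(i < w l') abp_vec w lab l' i * lab l'.+1 i j
  end.

Definition abp_value (R : comNzRingType) (w : nat -> nat)
    (lab : nat -> nat -> nat -> R) (L : nat) : R := abp_vec w lab L 0.

Definition abp_width (w : nat -> nat) (L : nat) : nat := (\max_(l < L.+1) w l)%N.

Definition abp_size (w : nat -> nat) (L : nat) : nat := (\sum_(l < L.+1) w l)%N.

Definition abp_shape (w : nat -> nat) (L : nat) : Prop :=
  w 0%N = 1%N /\ w L = 1%N.

Definition is_partition (k m : nat) (part : 'I_k -> 'I_m) : Prop :=
  forall b : 'I_m, exists x : 'I_k, part x = b.

Definition set_multilinear (F : fieldType) (k m : nat) (part : 'I_k -> 'I_m)
    (P : {mpoly F[k]}) : Prop :=
  forall mon : 'X_{1..k}, mon \in msupp P ->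
    forall b : 'I_m, (\sum_(x < k | part x == b) mon x)%N = 1%N.

Definition linear_form_in (F : fieldType) (k m : nat) (part : 'I_k -> 'I_m)
    (b : 'I_m) (q : {mpoly F[k]}) : Prop :=
  exists a : 'I_k -> F,
    (forall x, part x != b -> a x = 0) /\ q = \sum_(x < k) a x *: 'X_x.

Definition smABP (F : fieldType) (k m : nat) (part : 'I_k -> 'I_m)
    (sigma : 'S_m) (w : nat -> nat) (lab : nat -> nat -> nat -> {mpoly F[k]})
    : Prop :=
  abp_shape w m /\
  forall (l : 'I_m) (i j : nat), (i < w l)%N -> (j < w l.+1)%N ->
    linear_form_in part (sigma l) (lab l.+1 i j).

Definition sum_smABP_total_width_le (F : fieldType) (k m : nat)
    (part : 'I_k -> 'I_m) (P : {mpoly F[k]}) (t : nat) : Prop :=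
  exists (r : nat) (sigma : 'I_r -> 'S_m) (w : 'I_r -> nat -> nat)
         (lab : 'I_r -> nat -> nat -> nat -> {mpoly F[k]}),
    (forall i, smABP part (sigma i) (w i) (lab i)) /\
    \sum_(i < r) abp_value (w i) (lab i) m = P /\
    (\sum_(i < r) abp_width (w i) m <= t)%N.

Definition abp_size_le (F : fieldType) (k : nat) (P : {mpoly F[k]}) (s : nat)
    : Prop :=
  exists (L : nat) (w : nat -> nat) (lab : nat -> nat -> nat -> {mpoly F[k]}),
    abp_shape w L /\
    (forall l i j, (msize (lab l i j) <= 2)%N) /\
    abp_value w lab L = P /\ (abp_size w L <= s)%N.

Definition in_VBP (F : fieldType) (k : nat -> nat) (G : forall n, {mpoly F[k n]})
    : Prop :=
  exists c : nat, forall n : nat,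
    ((msize (G n)).-1 <= c * n.+1 ^ c)%N /\ abp_size_le (G n) (c * n.+1 ^ c).

Definition big_Theta (f g : nat -> nat) : Prop :=
  exists (c N : nat), forall n, (N <= n)%N ->
    (g n <= c * f n)%N /\ (f n <= c * g n)%N.

(* Main.v *)
Require Import Defs.
From HB Require Import structures.
From mathcomp Require Import all_boot all_order all_algebra all_fingroup.
From mathcomp Require Import mpoly.
From mathcomp Require Import zify.
Set Implicit Arguments. Unset Strict Implicit. Unset Printing Implicit Defensive.
Import GRing.Theory.
Local Open Scope ring_scope.

(* The blocks fall into g groups; a group has 2h position blocks and one
   selector block, with 2h about log n, so that each subset Y of the positions
   of a group is named by one of the n+1 selector variables. The polynomial of
   a group sums, over the selectors, the selector variable times a product of h
   inner products matching Y with its complement; G is the product over the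
   groups, and has a polynomial-size ABP.

   Choose in each group a balanced Y. Fixing the selectors accordingly, the
   coefficient matrix of G, with rows indexed by the monomials in the Y-blocks
   and columns by those in the other position blocks, is the identity matrix
   of size (n+1)^(gh). Cutting an ordered ABP after some layer bounds the rank
   of its matrix by width * (n+1)^(gh - K) as soon as the blocks read before
   the cut contain K more Y-blocks than other position blocks, or K fewer.
   Hence total width n^c is excluded by finding a choice of Y for which each of
   the at most n^c orders has a prefix of imbalance at least c+1.

   If all prefixes of an order have imbalance less than K, then Y contains no
   chunk of 2K consecutive positions, so for constant K such sets form a
   fraction exp(-Omega(gh)) of all subsets of the 2gh positions. Balanced
   choices form a fraction at least (2h+1)^(-g) = exp(-o(gh)), since h grows,
   and n^c exp(-Omega(gh)) is small because gh = Theta(d) and d = omega(log n);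
   a union bound over the orders concludes. *)

(** * Closure properties of branching programs *)

(** The depth [L] is a parameter, unlike in [abp_size_le]: sums are formed layer by layer and need
    summands of equal depth. *)
Definition abp_computes (F : fieldType) (k L s : nat) (P : {mpoly F[k]}) : Prop :=
  exists (w : nat -> nat) (lab : nat -> nat -> nat -> {mpoly F[k]}),
    abp_shape w L /\
    (forall l i j, (msize (lab l i j) <= 2)%N) /\
    abp_value w lab L = P /\ (abp_size w L <= s)%N.

Lemma abp_computes_linear (F : fieldType) (k : nat) (P : {mpoly F[k]}) :
  (msize P <= 2)%N -> abp_computes 1 2 P.
Proof.
move=> szP; exists (fun=> 1%N), (fun _ _ _ => P); do 3?split=> //.
  by rewrite /abp_value /= big_ord1 /= mul1r.
by rewrite /abp_size !big_ord_recr big_ord0.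
Qed.

Lemma abp_computes1 (F : fieldType) (k : nat) : abp_computes 0 1 (1 : {mpoly F[k]}).
Proof.
exists (fun=> 1%N), (fun _ _ _ => 0); do 3?split=> //.
  by move=> *; rewrite msize0.
by rewrite /abp_size big_ord_recr big_ord0.
Qed.

Lemma abp_computes0 (F : fieldType) (k L : nat) :
  (0 < L)%N -> abp_computes L L.+1 (0 : {mpoly F[k]}).
Proof.
move=> L0; exists (fun=> 1%N), (fun _ _ _ => 0); do 3?split=> //.
- by move=> *; rewrite msize0.
- by case: L L0 => // L _; rewrite /abp_value /= big_ord1 mulr0.
by rewrite /abp_size sum1_card card_ord.
Qed.

Lemma abp_computesM (F : fieldType) (k L1 L2 s1 s2 : nat) (P Q : {mpoly F[k]}) :
  abp_computes L1 s1 P -> abp_computes L2 s2 Q ->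
  abp_computes (L1 + L2) (s1 + s2) (P * Q).
Proof.
move=> [w1 [lab1 [[w10 w1L] [sz1 [val1 le1]]]]].
move=> [w2 [lab2 [[w20 w2L] [sz2 [val2 le2]]]]].
pose w l := if (l <= L1)%N then w1 l else w2 (l - L1)%N.
pose lab l i j := if (l <= L1)%N then lab1 l i j else lab2 (l - L1)%N i j.
have wE l : w (L1 + l)%N = w2 l.
  rewrite /w; case: l => [|l]; first by rewrite addn0 leqnn w1L w20.
  by rewrite -[X in (_ <= X)%N]addn0 leq_add2l /= addKn.
have vec1 l j : (l <= L1)%N -> abp_vec w lab l j = abp_vec w1 lab1 l j.
  elim: l j => [|l IH] j lel //=.
  rewrite /w /lab (ltnW lel) lel; apply: eq_bigr => i _.
  by rewrite -IH ?(ltnW lel).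
have vec2 l j : (j < w2 l)%N ->
    abp_vec w lab (L1 + l) j = P * abp_vec w2 lab2 l j.
  elim: l j => [|l IH] j ltj.
    rewrite addn0 vec1 // /=; move: ltj; rewrite w20; case: j => // _.
    by rewrite mulr1.
  rewrite addnS /= wE mulr_sumr; apply: eq_bigr => i _.
  rewrite IH ?ltn_ord // mulrA; congr (_ * _).
  by rewrite /lab ltnNge leq_addr /= -addnS addKn.
exists w, lab; split; last split; last split.
- by split; [rewrite /w leq0n | rewrite wE].
- by move=> l i j; rewrite /lab; case: ifP.
- by rewrite /abp_value vec2 ?w2L // -val2.
apply: leq_trans (leq_add le1 le2).
rewrite /abp_size -!(big_mkord xpredT) (@big_cat_nat _ _ _ L1.+1) //=; last first.
  by rewrite ltnS leq_addr.
apply: leq_add.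
  rewrite big_nat [leqRHS]big_nat; apply: leq_sum => i.
  by rewrite /w ltnS => /andP[_ ->].
rewrite [leqRHS]big_nat_recl //; apply: leq_trans (leq_addl _ _).
rewrite -[L1.+1]add0n big_addn subSS addKn; apply: leq_sum => i _.
by rewrite addnS -addSn addnC wE.
Qed.

(** Parallel composition: inner layers become disjoint unions, while the two start nodes are merged
    and so are the two end nodes. *)
Lemma abp_computesD (F : fieldType) (k L s1 s2 : nat) (P Q : {mpoly F[k]}) :
  (0 < L)%N -> abp_computes L s1 P -> abp_computes L s2 Q ->
  abp_computes L (s1 + s2) (P + Q).
Proof.
move=> L0 [w1 [lab1 [[w10 w1L] [sz1 [val1 le1]]]]].
move=> [w2 [lab2 [[w20 w2L] [sz2 [val2 le2]]]]].
pose w l := if (l == 0%N) || (l == L) then 1%N else (w1 l + w2 l)%N.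
(* In layer [l] the nodes of the second program begin at index [off l], which is zero in the two
   merged layers. *)
pose off l := if (l == 0%N) || (l == L) then 0%N else w1 l.
pose lab l i j : {mpoly F[k]} :=
  (if (i < w1 l.-1)%N && (j < w1 l)%N then lab1 l i j else 0) +
  (if (off l.-1 <= i)%N && (off l <= j)%N then
     lab2 l (i - off l.-1)%N (j - off l)%N else 0).
(* Layer 0 is excluded: at the merged start node both vectors are 1, and so is the combined one. *)
have vec l j : (0 < l <= L)%N -> (j < w l)%N ->
    abp_vec w lab l j = (if (j < w1 l)%N then abp_vec w1 lab1 l j else 0) +
       (if (off l <= j)%N then abp_vec w2 lab2 l (j - off l) else 0).
  elim: l j => [|l IH] j //= lel ltj.
  have [l0|l0] := posnP l.
    subst l; have w00 : w 0%N = 1%N by [].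
    by rewrite w00 w10 w20 !big_ord1 /= !mul1r /lab /= w10.
  have lL : (l == L) = false by apply: negbTE; rewrite neq_ltn lel.
  have l00 : (l == 0)%N = false by apply: negbTE; rewrite -lt0n.
  have offl : off l = w1 l by rewrite /off lL l00.
  have wl : w l = (w1 l + w2 l)%N by rewrite /w lL l00.
  rewrite wl big_split_ord /=; congr (_ + _).
    case: ifP => ltj1; last first.
      apply: big1 => i _; rewrite IH; last 2 first.
      - by rewrite l0 ltnW.
      - by rewrite wl ltn_addr.
      by rewrite /lab /= ltj1 andbF offl [(w1 l <= i)%N]leqNgt ltn_ord /= !addr0 mulr0.
    apply: eq_bigr => i _; rewrite IH; last 2 first.
    - by rewrite l0 ltnW.
    - by rewrite wl ltn_addr.
    by rewrite /lab /= ltj1 offl [(w1 l <= i)%N]leqNgt !ltn_ord /= !addr0.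
  case: ifP => lej; last first.
    apply: big1 => i _; rewrite /lab /= lej andbF ltnNge leq_addr /=.
    by rewrite addr0 mulr0.
  apply: eq_bigr => i _; rewrite IH; last 2 first.
  - by rewrite l0 ltnW.
  - by rewrite wl ltn_add2l.
  by rewrite /lab /= lej offl ltnNge leq_addr /= !add0r addKn.
have wL : w L = 1%N by rewrite /w eqxx orbT.
have offL : off L = 0%N by rewrite /off eqxx orbT.
exists w, lab; split; last split; last split.
- by [].
- move=> l i j; rewrite /lab; apply: leq_trans (msizeD_le _ _) _.
  by rewrite geq_max; apply/andP; split; case: ifP => _; rewrite ?msize0.
- by rewrite /abp_value vec ?wL ?L0 //= w1L offL -val1 -val2.
apply: leq_trans (leq_add le1 le2); rewrite /abp_size -big_split /=.
apply: leq_sum => i _; rewrite /w; case: eqP => [->|_] /=; first by rewrite w10.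
by case: eqP => [->|_] //=; rewrite w1L.
Qed.

Lemma abp_computes_prod (F : fieldType) (k L s n : nat)
    (P : 'I_n -> {mpoly F[k]}) :
  (forall i, abp_computes L s (P i)) ->
  abp_computes (n * L) (n * s + 1) (\prod_(i < n) P i).
Proof.
elim: n P => [|n IH] P cP; first by rewrite big_ord0; exact: abp_computes1.
by rewrite big_ord_recl !mulSn -addnA; apply: abp_computesM => //; apply: IH.
Qed.

Lemma abp_computes_sum (F : fieldType) (k L s n : nat)
    (P : 'I_n -> {mpoly F[k]}) :
  (0 < L)%N -> (forall i, abp_computes L s (P i)) ->
  abp_computes L (n * s + L.+1) (\sum_(i < n) P i).
Proof.
move=> L0; elim: n P => [|n IH] P cP; first by rewrite big_ord0; exact: abp_computes0.
by rewrite big_ord_recl mulSn -addnA; apply: abp_computesD => //; apply: IH.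
Qed.

(** * Cutting a branching program *)

(** The sum over paths from node [q] of layer [l] to node [j] of layer [l + t], the factor lying
    after a cut at layer [l]. *)
Fixpoint abp_from (R : comNzRingType) (w : nat -> nat)
    (lab : nat -> nat -> nat -> R) (l q t : nat) : nat -> R :=
  match t with
  | 0 => fun j => (j == q)%:R
  | t'.+1 => fun j =>
      \sum_(i < w (l + t')%N) abp_from w lab l q t' i * lab (l + t').+1 i j
  end.

Lemma abp_vec_cut (R : comNzRingType) (w : nat -> nat)
    (lab : nat -> nat -> nat -> R) (l t j : nat) : (j < w (l + t))%N ->
  abp_vec w lab (l + t) j =
    \sum_(q < w l) abp_vec w lab l q * abp_from w lab l q t j.
Proof.
elim: t j => [|t IH] j /=.
  rewrite addn0 => ltj; rewrite (bigD1 (Ordinal ltj)) //= eqxx mulr1.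
  rewrite big1 ?addr0 // => q; rewrite -val_eqE /= eq_sym => /negbTE->.
  by rewrite mulr0.
rewrite addnS => ltj /=.
under eq_bigr => i _ do rewrite IH // mulr_suml.
rewrite exchange_big /=; apply: eq_bigr => q _.
by rewrite mulr_sumr; apply: eq_bigr => i _; rewrite mulrA.
Qed.

Lemma eq_abp_vec (R : comNzRingType) (w : nat -> nat)
    (lab lab' : nat -> nat -> nat -> R) (l j : nat) :
  (forall l' i i', (l' < l)%N -> (i < w l')%N -> (i' < w l'.+1)%N ->
     lab l'.+1 i i' = lab' l'.+1 i i') ->
  (j < w l)%N -> abp_vec w lab l j = abp_vec w lab' l j.
Proof.
elim: l j => [|l IH] j eqlab ltj //=; apply: eq_bigr => i _.
rewrite IH ?eqlab // => l' i1 i2 ltl; exact/eqlab/ltnW.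
Qed.

Lemma eq_abp_from (R : comNzRingType) (w : nat -> nat)
    (lab lab' : nat -> nat -> nat -> R) (l q t j : nat) :
  (forall l' i i', (l <= l' < l + t)%N -> (i < w l')%N -> (i' < w l'.+1)%N ->
     lab l'.+1 i i' = lab' l'.+1 i i') ->
  (j < w (l + t))%N -> abp_from w lab l q t j = abp_from w lab' l q t j.
Proof.
elim: t j => [|t IH] j //; rewrite addnS => eqlab ltj /=; apply: eq_bigr => i _.
rewrite IH ?eqlab ?leq_addr //= => l' i1 i2 /andP[lel ltl].
by apply: eqlab; rewrite lel ltnW.
Qed.

Lemma rmorph_abp_vec (R S : comNzRingType) (f : {rmorphism R -> S})
    (w : nat -> nat) (lab : nat -> nat -> nat -> R) (l j : nat) :
  f (abp_vec w lab l j) = abp_vec w (fun l i j => f (lab l i j)) l j.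
Proof.
elim: l j => [|l IH] j /=; first by case: ifP; rewrite ?rmorph1 ?rmorph0.
by rewrite rmorph_sum; apply: eq_bigr => i _; rewrite rmorphM IH.
Qed.

(** * Ranks of matrices indexed by a finite type *)

Definition kernel_mx (F : fieldType) (S : finType) (M : S -> S -> F) :
    'M[F]_#|S| :=
  \matrix_(i, j) M (enum_val i) (enum_val j).

Lemma rank_kernel1 (F : fieldType) (S : finType) :
  \rank (kernel_mx (fun u v : S => (u == v)%:R : F)) = #|S|.
Proof.
rewrite (_ : kernel_mx _ = 1%:M) ?mxrank1 //; apply/matrixP => i j.
by rewrite !mxE (inj_eq enum_val_inj).
Qed.

Lemma rank_kernel_sum (F : fieldType) (S : finType) (r : nat)
    (M : 'I_r -> S -> S -> F) :
  (\rank (kernel_mx (fun u v => (\sum_i M i u v)%R)) <=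
     \sum_i \rank (kernel_mx (M i)))%N.
Proof.
rewrite (_ : kernel_mx _ = (\sum_i kernel_mx (M i))%R); last first.
  by apply/matrixP => i j; rewrite mxE summxE; apply: eq_bigr => a _; rewrite mxE.
elim/big_rec2: _ => [|i a B _ IH]; first by rewrite mxrank0.
apply: leq_trans (mxrank_add _ _) _; exact: leq_add.
Qed.

Lemma rank_kernel_factor (F : fieldType) (S I : finType) (A : {pred I})
    (M : S -> S -> F) (f : S -> I -> F) (g : I -> S -> F) :
  (forall u v, M u v = \sum_(i in A) f u i * g i v) ->
  (\rank (kernel_mx M) <= #|A|)%N.
Proof.
move=> ME.
pose B : 'M[F]_(#|S|, #|A|) := \matrix_(i, j) f (enum_val i) (enum_val j).
pose C : 'M[F]_(#|A|, #|S|) := \matrix_(i, j) g (enum_val i) (enum_val j).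
rewrite (_ : kernel_mx M = B *m C) ?mulmx_max_rank //; apply/matrixP => i j.
rewrite !mxE ME big_enum_val; apply: eq_bigr => a _; by rewrite !mxE.
Qed.

(** Values off [A] are reset to zero rather than dropped, so that restrictions are counted as total
    functions supported in [A]. *)
Definition restrict (E : finType) (N : nat) (A : {set E})
    (u : {ffun E -> 'I_N.+1}) : {ffun E -> 'I_N.+1} :=
  [ffun e => if e \in A then u e else ord0].

Lemma restrict_in (E : finType) (N : nat) (A : {set E})
    (u : {ffun E -> 'I_N.+1}) :
  restrict A u \in pffun_on ord0 (mem A) predT.
Proof.
apply/pffun_onP; split=> //; apply/subsetP => e.
by rewrite unfold_in /= ffunE; case: ifP => // _; rewrite eqxx.
Qed.

(** Put [p] on the row side and [s] on the column side. The row side then lacks only [v] on [B], the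
    column side only [u] off [A]; summing over these values besides [q] gives the factorisation. *)
Lemma rank_kernel_cut (F : fieldType) (E : finType) (N w : nat) (A B : {set E})
    (p s : 'I_w -> {ffun E -> 'I_N.+1} -> {ffun E -> 'I_N.+1} -> F) :
  (forall q (u u' v v' : {ffun E -> 'I_N.+1}),
     {in A, forall e, u e = u' e} ->
     {in B, forall e, v e = v' e} ->
     p q u v = p q u' v') ->
  (forall q (u u' v v' : {ffun E -> 'I_N.+1}),
     {in ~: A, forall e, u e = u' e} ->
     {in ~: B, forall e, v e = v' e} ->
     s q u v = s q u' v') ->
  (\rank (kernel_mx (fun u v => (\sum_q p q u v * s q u v)%R)) <=
     w * N.+1 ^ (#|B| + #|~: A|))%N.
Proof.
move=> pP sP.
(* the middle index records the restriction of [v] to [B] and of [u] off [A] *)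
pose T : finType :=
  ('I_w * ({ffun E -> 'I_N.+1} * {ffun E -> 'I_N.+1}))%type.
pose X : {set {ffun E -> 'I_N.+1}} := [set x in pffun_on ord0 (mem B) predT].
pose Y : {set {ffun E -> 'I_N.+1}} := [set x in pffun_on ord0 (mem (~: A)) predT].
pose I : {set T} := setX [set: 'I_w] (setX X Y).
have cardI : #|I| = (w * N.+1 ^ (#|B| + #|~: A|))%N.
  have card_pf (Z : {set E}) :
      #|[set x in pffun_on (ord0 : 'I_N.+1) (mem Z) predT]| = (N.+1 ^ #|Z|)%N.
    by rewrite cardsE card_pffun_on cardT size_enum_ord.
  by rewrite !cardsX cardsT card_ord !card_pf expnD.
rewrite -cardI.
pose f (u : {ffun E -> 'I_N.+1}) (i : T) : F :=
  (restrict (~: A) u == i.2.2)%:R * p i.1 u i.2.1.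
pose g (i : T) (v : {ffun E -> 'I_N.+1}) : F :=
  (restrict B v == i.2.1)%:R * s i.1 i.2.2 v.
apply: (@rank_kernel_factor F _ T (mem I) _ f g) => u v.
rewrite (partition_big (fun i : T => i.1) predT) //=; apply: eq_bigr => q _.
rewrite (bigD1 (q, (restrict B v, restrict (~: A) u))) /=; last first.
  rewrite eqxx andbT; change (is_true ((q, (restrict B v, restrict (~: A) u)) \in I)).
  by rewrite !in_setX in_setT /= {1}/X {1}/Y !in_set !restrict_in.
rewrite /f /g /= !eqxx !mul1r big1 ?addr0; last first.
  move=> [q' [x y]] /= /andP[/andP[_ /eqP->]]; rewrite !xpair_eqE eqxx /= => nxy.
  rewrite mulrCA mulrA mulrA -natrM mulnb [_ == x]eq_sym [_ == y]eq_sym.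
  by rewrite [(x == _) && _](negbTE nxy) !mul0r.
congr (_ * _).
  by apply: pP => // e eB; rewrite ffunE eB.
by apply: sP => // e eA; rewrite ffunE eA.
Qed.

(** * Sets of low discrepancy along an order *)

Local Close Scope ring_scope.

(** A uniformly random set contains a chunk of [K] points with probability [1 / 2 ^ K],
    independently for disjoint chunks; denominators are cleared. *)
Lemma card_avoid_chunks (P : finType) (T K : nat) (C : nat -> {set P}) :
  (forall i, (i < T)%N -> #|C i| = K) ->
  (forall i j, (i < j < T)%N -> [disjoint C i & C j]) ->
  (#|[set Y : {set P} | [forall i : 'I_T, ~~ (C i \subset Y)]]|
     * (2 ^ K) ^ T <= 2 ^ #|P| * (2 ^ K).-1 ^ T)%N.
Proof.
elim: T => [|T IH] cC dC.
  rewrite !expn0 !muln1 -[X in (_ <= 2 ^ X)%N]cardsT -card_powerset subset_leq_card //.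
  by apply/subsetP => Y _; rewrite powersetE subsetT.
set S := [set Y : {set P} | _]; rewrite !expnSr.
set q := (2 ^ K)%N in IH *.
have q0 : (0 < q)%N by rewrite expn_gt0.
set S' := [set Y : {set P} | [forall i : 'I_T, ~~ (C i \subset Y)]] in IH.
have {}IH : (#|S'| * q ^ T <= 2 ^ #|P| * q.-1 ^ T)%N.
  by apply: IH => [i ltT|i j ltT]; [apply: cC | apply: dC]; lia.
pose S1 := [set Y in S' | C T \subset Y].
have SE : S = S' :\: S1.
  apply/setP => Y; rewrite !inE; apply/forallP/idP => [avoid|].
    rewrite (negbTE (avoid ord_max)) andbF /=; apply/forallP => i.
    exact: (avoid (widen_ord (leqnSn T) i)).
  move=> /andP[]; case: forallP => //= avoid nCT _ i.
  case: (unliftP ord_max i) => [i' ->|->] //; have := avoid i'.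
  by rewrite lift_max.
have S1S : S1 \subset S' by apply/subsetP => Y; rewrite inE => /andP[].
(* [Y |-> Y :|: C T] maps S' to S1, and its fibres have at most [q] points *)
have fib : (#|S'| <= #|S1| * q)%N.
  rewrite /q -(cC T) // -card_powerset -cardsX.
  pose f (Y : {set P}) := (Y :|: C T, Y :&: C T).
  have finj : injective f.
    move=> Y Z [/setP eU /setP eI]; apply/setP => x; move: (eU x) (eI x).
    by rewrite !inE; case: (x \in C T); rewrite ?orbF ?andbT.
  rewrite -(card_imset _ finj); apply/subset_leq_card/subsetP => _ /imsetP[Y YS ->].
  rewrite !inE /= subsetUr subsetIr !andbT; move: YS; rewrite inE.
  move=> /forallP avoid; apply/forallP => i; apply: contra (avoid i).
  move=> /subsetP sub; apply/subsetP => x xC; have := sub x xC.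
  rewrite inE => /orP[//|xT].
  have := dC i T; rewrite ltn_ord ltnSn => /(_ isT) /disjointFr /(_ xC).
  by rewrite xT.
have cS : (#|S| = #|S'| - #|S1|)%N by rewrite SE cardsD (setIidPr S1S).
have leS : (#|S| * q <= #|S'| * q.-1)%N.
  have := subset_leq_card S1S; rewrite cS; case: (q) q0 fib => //= q' _; nia.
rewrite mulnA mulnAC (leq_trans (leq_mul leS (leqnn _))) //.
by rewrite mulnAC [leqRHS]mulnA leq_mul2r IH orbT.
Qed.

Definition prefix_set (P : finType) (m : nat) (lay : P -> 'I_m) (l : nat) : {set P} :=
  [set x | (lay x < l)%N].

Lemma prefix_set_mono (P : finType) (m : nat) (lay : P -> 'I_m) (l l' : nat) :
  (l <= l')%N -> prefix_set lay l \subset prefix_set lay l'.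
Proof.
by move=> lel; apply/subsetP => x; rewrite !inE => /leq_trans; apply.
Qed.

(** Discrete continuity: as [lay] is injective, each layer adds at most one position to the
    prefix. *)
Lemma prefix_set_hits (P : finType) (m : nat) (lay : P -> 'I_m) (k : nat) :
  injective lay -> (k <= #|P|)%N ->
  exists l : 'I_m.+1, #|prefix_set lay l| = k.
Proof.
move=> injl lek.
have step l : (#|prefix_set lay l.+1| <= #|prefix_set lay l|.+1)%N.
  have sub : prefix_set lay l.+1 \subset prefix_set lay l :|: [set x | lay x == l :> nat].
    by apply/subsetP => x; rewrite !inE ltnS leq_eqVlt orbC.
  apply: leq_trans (subset_leq_card sub) _; apply: leq_trans (leq_card_setU _ _).1 _.
  rewrite -addn1 leq_add2l; apply/card_le1_eqP => x y; rewrite !inE.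
  by move=> /eqP lx /eqP ly; apply/injl/val_inj; rewrite /= lx ly.
have hits L : (k <= #|prefix_set lay L|)%N ->
    exists2 l, (l <= L)%N & #|prefix_set lay l| = k.
  elim: L => [|L IH] leL.
    exists 0%N => //; have -> : prefix_set lay 0 = set0 by apply/setP => x; rewrite !inE.
    by move: leL; rewrite (_ : prefix_set lay 0 = set0) ?cards0;
      [rewrite leqn0 => /eqP|apply/setP => x; rewrite !inE].
  have [/IH[l lel <-]|ltk] := leqP k #|prefix_set lay L|.
    by exists l => //; apply: leqW.
  exists L.+1 => //; apply/eqP; rewrite eqn_leq leL andbT.
  exact: leq_trans (step L) ltk.
have [|l lel <-] := hits m.
  rewrite (_ : prefix_set lay m = [set: P]) ?cardsT //.
  by apply/setP => x; rewrite !inE ltn_ord.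
by exists (Ordinal (lel : l < m.+1)%N).
Qed.

(** Cut an initial part of the order into [T] chunks of [K.*2] positions. A chunk inside [Y] raises
    the imbalance by [K.*2], which cannot happen strictly between [-K] and [K]; so [Y] contains no
    chunk. *)
Lemma card_low_discrepancy (P : finType) (m : nat) (lay : P -> 'I_m) (T K : nat) :
  injective lay -> (T * K.*2 <= #|P|)%N ->
  (#|[set Y : {set P} | [forall l : 'I_m.+1,
        (#|prefix_set lay l :\: Y| < #|prefix_set lay l :&: Y| + K)%N &&
        (#|prefix_set lay l :&: Y| < #|prefix_set lay l :\: Y| + K)%N]]|
     * (2 ^ K.*2) ^ T <= 2 ^ #|P| * (2 ^ K.*2).-1 ^ T)%N.
Proof.
move=> injl leT.
pose pre l := prefix_set lay l.
(* A layer before which exactly [c * K.*2] positions are read; the default [ord0] is never reached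
   for [c <= T]. *)
pose L c : 'I_m.+1 := odflt ord0 [pick l : 'I_m.+1 | #|pre l| == (c * K.*2)%N].
have cardL c : (c <= T)%N -> #|pre (L c)| = (c * K.*2)%N.
  move=> lec; rewrite /L; case: pickP => [l /eqP //|no].
  have [|l /eqP] := @prefix_set_hits P m lay (c * K.*2) injl.
    by apply: leq_trans leT; rewrite leq_mul2r lec orbT.
  by rewrite no.
have sub c c' : (c <= c' <= T)%N -> pre (L c) \subset pre (L c').
  move=> /andP[lec leT']; have [lel|ltl] := leqP (L c) (L c').
    exact: prefix_set_mono.
  have sub' : pre (L c') \subset pre (L c) by apply/prefix_set_mono/ltnW.
  have/eqP<- // : pre (L c') == pre (L c).
  by rewrite eqEcard sub' !cardL ?leq_mul2r ?lec ?orbT // (leq_trans lec).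
pose C c := pre (L c.+1) :\: pre (L c).
apply: leq_trans (card_avoid_chunks (K := K.*2) (C := C) (T := T) _ _); last first.
- move=> i j ltij; rewrite -setI_eq0; apply/eqP/setP => x; rewrite !inE.
  apply/negP => /andP[/andP[_ xi] /andP[/negP xj _]]; apply: xj.
  have /subsetP/(_ x) : pre (L i.+1) \subset pre (L j) by apply: sub; lia.
  by rewrite !inE; apply.
- move=> i ltT; rewrite cardsD (setIidPr (sub i i.+1 _)) ?leqnSn //.
  by rewrite !cardL ?(ltnW ltT) // mulSn addnK.
rewrite leq_mul2r; apply/orP; right; apply/subset_leq_card/subsetP => Y.
rewrite !inE => /forallP disc; apply/forallP => c; apply/negP => subY.
(* The lower bound on the imbalance at the start of the chunk and the upper bound at its end
   contradict a jump by [K.*2]. *)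
have [/andP[lo _] /andP[_ hi]] := (disc (L c), disc (L c.+1)).
have subc : pre (L c) \subset pre (L c.+1) by apply: sub; rewrite leqnSn /=.
have cC : #|C c| = K.*2.
  by rewrite cardsD (setIidPr subc) !cardL ?(ltnW (ltn_ord c)) // mulSn addnK.
have preE : pre (L c.+1) = pre (L c) :|: C c.
  apply/setP => x; rewrite !inE; case: (boolP (lay x < L c)%N) => //= xL.
  by have /subsetP/(_ x) := subc; rewrite !inE; apply.
have inY : (#|pre (L c) :&: Y| + K.*2 <= #|pre (L c.+1) :&: Y|)%N.
  rewrite preE -cC setIUl (setIidPl subY) cardsU.
  suff -> : pre (L c) :&: Y :&: C c = set0 by rewrite cards0 subn0.
  by apply/setP => x; rewrite !inE; case: (_ < L c)%N => //=; rewrite ?andbF.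
have outY : #|pre (L c.+1) :\: Y| = #|pre (L c) :\: Y|.
  congr #|pred_of_set _|; rewrite preE setDUl.
  by rewrite (_ : C c :\: Y = set0) ?setU0 //; apply/eqP; rewrite setD_eq0.
have {}lo : (#|pre (L c) :\: Y| < #|pre (L c) :&: Y| + K)%N := lo.
have {}hi : (#|pre (L c.+1) :&: Y| < #|pre (L c) :\: Y| + K)%N by rewrite -outY.
by move: inY lo hi; rewrite -addnn; lia.
Qed.

Local Open Scope ring_scope.

(** * The hard polynomial *)

(** The variables are the entries of an [m] by [N] matrix flattened as by [mxvec]; its rows are the
    blocks. *)
Definition mx_coord (m N : nat) (x : 'I_(m * N)) : 'I_m * 'I_N :=
  enum_val (cast_ord (esym (mxvec_cast m N)) x).

Definition block (m N : nat) (x : 'I_(m * N)) : 'I_m := (mx_coord x).1.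

Lemma mx_coordK (m N : nat) (i : 'I_m) (j : 'I_N) :
  mx_coord (mxvec_index i j) = (i, j).
Proof. by rewrite /mx_coord /mxvec_index cast_ordK enum_rankK. Qed.

Lemma block_mxvec_index (m N : nat) (i : 'I_m) (j : 'I_N) :
  block (mxvec_index i j) = i.
Proof. by rewrite /block mx_coordK. Qed.

Lemma mxvec_index_inj (m N : nat) (i i' : 'I_m) (j j' : 'I_N) :
  (mxvec_index i j == mxvec_index i' j') = (i == i') && (j == j').
Proof.
apply/eqP/andP => [/(congr1 (@mx_coord m N))|[/eqP-> /eqP->] //].
by rewrite !mx_coordK => -[-> ->].
Qed.

(** On a set-multilinear polynomial, evaluation at this 0/1 point extracts the coefficient of the
    monomial that takes variable [th b] from each block [b]. *)
Definition selection (F : fieldType) (m N : nat) (th : 'I_m -> 'I_N) :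
    'I_(m * N) -> F :=
  fun x => (th (block x) == (mx_coord x).2)%:R.

Lemma linear_form_selection (F : fieldType) (m N : nat) (b : 'I_m)
    (q : {mpoly F[m * N]}) (th th' : 'I_m -> 'I_N) :
  linear_form_in (@block m N) b q -> th b = th' b ->
  q.@[selection F th] = q.@[selection F th'].
Proof.
move=> [a [a0 ->]] eqth; rewrite !rmorph_sum; apply: eq_bigr => x _ /=.
rewrite !mevalZ !mevalXU /selection.
by have [->|/a0->] := eqVneq (block x) b; rewrite ?eqth ?mul0r.
Qed.

(** With [u] as row index and [v] as column index, evaluating at these choices produces the
    coefficient matrix; [dflt] will fix the selector blocks. *)
Definition spread (E : finType) (m N : nat) (row col : E -> 'I_m)
    (dflt : 'I_m -> 'I_N) (u v : {ffun E -> 'I_N}) (b : 'I_m) : 'I_N :=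
  if [pick e | row e == b] is Some e then u e
  else if [pick e | col e == b] is Some e then v e else dflt b.

(* [(sigma^-1)%g b] is the layer of the branching program that reads block [b] *)
Definition early (E : finType) (m : nat) (sigma : 'S_m) (pos : E -> 'I_m) (l : nat) :
    {set E} :=
  prefix_set (fun e => (sigma^-1)%g (pos e)) l.

Lemma eq_spread (E : finType) (m N : nat) (row col : E -> 'I_m)
    (dflt : 'I_m -> 'I_N) (u u' v v' : {ffun E -> 'I_N}) (b : 'I_m) :
  (forall e, row e = b -> u e = u' e) -> (forall e, col e = b -> v e = v' e) ->
  spread row col dflt u v b = spread row col dflt u' v' b.
Proof.
rewrite /spread => eu ev; case: pickP => [e /eqP/eu //|_].
by case: pickP => [e /eqP/ev //|_].
Qed.

(** A label depends only on the choice in its own block, so the prefix sees [u] on [A] and [v] on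
    [B], and the suffix sees the rest. There are two bounds because either factor can go to the row
    side; the sign of the imbalance decides which is useful. *)
Lemma smABP_rank_cut (F : fieldType) (E : finType) (m N : nat) (row col : E -> 'I_m)
    (dflt : 'I_m -> 'I_N.+1) (sigma : 'S_m) (w : nat -> nat)
    (lab : nat -> nat -> nat -> {mpoly F[m * N.+1]}) (l : 'I_m.+1) :
  smABP (@block m N.+1) sigma w lab ->
  let A := early sigma row l in let B := early sigma col l in
  let M := fun u v =>
    (abp_value w lab m).@[selection F (spread row col dflt u v)] in
  (\rank (kernel_mx M) <= w l * N.+1 ^ (#|B| + #|~: A|))%N /\
  (\rank (kernel_mx M) <= w l * N.+1 ^ (#|~: B| + #|A|))%N.
Proof.
move=> [[w0 wm] lin] A B M.
pose ev u v := selection F (spread row col dflt u v).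
pose labe u v l i j := (lab l i j).@[ev u v].
have lem : (l <= m)%N by rewrite -ltnS.
have cut (lb : nat -> nat -> nat -> F) : abp_vec w lb m 0 =
    \sum_(q < w l) abp_vec w lb l q * abp_from w lb l q (m - l) 0.
  by rewrite -{1}(subnKC lem) abp_vec_cut // subnKC // wm.
have ME u v : M u v = \sum_(q < w l)
    abp_vec w (labe u v) l q * abp_from w (labe u v) l q (m - l) 0.
  by rewrite /M /abp_value rmorph_abp_vec cut.
have labE (l' i j : nat) (u u' v v' : {ffun E -> 'I_N.+1}) :
    (l' < m)%N -> (i < w l')%N -> (j < w l'.+1)%N ->
    (forall e, (sigma^-1)%g (row e) = l' :> nat -> u e = u' e) ->
    (forall e, (sigma^-1)%g (col e) = l' :> nat -> v e = v' e) ->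
    labe u v l'.+1 i j = labe u' v' l'.+1 i j.
  move=> ltl lti ltj eu ev'; apply: linear_form_selection (lin (Ordinal ltl) _ _ lti ltj) _.
  apply: eq_spread => e eb; [apply: eu | apply: ev']; by rewrite eb permK.
have dep_pre (q : 'I_(w l)) (u u' v v' : {ffun E -> 'I_N.+1}) :
    {in A, forall e, u e = u' e} -> {in B, forall e, v e = v' e} ->
    abp_vec w (labe u v) l q = abp_vec w (labe u' v') l q.
  move=> eu ev'; apply: eq_abp_vec => // l' i j ltl lti ltj.
  by apply: labE => // [|e le|e le]; [exact: leq_trans lem | apply: eu | apply: ev'];
    rewrite inE le.
have dep_suf (q : 'I_(w l)) (u u' v v' : {ffun E -> 'I_N.+1}) :
    {in ~: A, forall e, u e = u' e} -> {in ~: B, forall e, v e = v' e} ->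
    abp_from w (labe u v) l q (m - l) 0 = abp_from w (labe u' v') l q (m - l) 0.
  move=> eu ev'; apply: eq_abp_from => [l' i j|]; rewrite subnKC // ?wm //.
  move=> /andP[lel ltl] lti ltj.
  by apply: labE => // e le; [apply: eu | apply: ev']; rewrite !inE le -leqNgt.
split.
  rewrite (_ : kernel_mx M = kernel_mx (fun u v => \sum_(q < w l)
    abp_vec w (labe u v) l q * abp_from w (labe u v) l q (m - l) 0)).
    exact: (rank_kernel_cut (A := A) (B := B)
      (p := fun q u v => abp_vec w (labe u v) l q)
      (s := fun q u v => abp_from w (labe u v) l q (m - l) 0)).
  by apply/matrixP => i j; rewrite !mxE ME.
rewrite (_ : kernel_mx M = kernel_mx (fun u v => \sum_(q < w l)
    abp_from w (labe u v) l q (m - l) 0 * abp_vec w (labe u v) l q)).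
  have -> : #|A| = #|~: ~: A| by rewrite setCK.
  apply: (rank_kernel_cut (A := ~: A) (B := ~: B)
      (s := fun q u v => abp_vec w (labe u v) l q)
      (p := fun q u v => abp_from w (labe u v) l q (m - l) 0)) => //.
  by move=> q u u' v v'; rewrite !setCK; exact: dep_pre.
by apply/matrixP => i j; rewrite !mxE ME; apply: eq_bigr => q _; rewrite mulrC.
Qed.

(** * Counting the variables of each block in a monomial *)

Definition has_block_weight (F : fieldType) (m N : nat) (beta : 'I_m -> nat)
    (P : {mpoly F[m * N]}) : Prop :=
  forall mon : 'X_{1..m * N}, mon \in msupp P ->
    forall b : 'I_m, (\sum_(x | block x == b) mon x)%N = beta b.

Lemma eq_block_weight (F : fieldType) (m N : nat) (beta beta' : 'I_m -> nat)
    (P : {mpoly F[m * N]}) :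
  beta =1 beta' -> has_block_weight beta P -> has_block_weight beta' P.
Proof. by move=> eqb hP mon /hP hb b; rewrite hb eqb. Qed.

Lemma block_weight1 (F : fieldType) (m N : nat) :
  has_block_weight (fun=> 0%N) (1 : {mpoly F[m * N]}).
Proof.
by move=> mon; rewrite msupp1 inE => /eqP-> b; apply: big1 => x _; rewrite mnm0E.
Qed.

Lemma block_weightX (F : fieldType) (m N : nat) (b0 : 'I_m) (a : 'I_N) :
  has_block_weight (fun b => (b == b0) : nat)
    ('X_(mxvec_index b0 a) : {mpoly F[m * N]}).
Proof.
move=> mon; rewrite msuppX inE => /eqP-> b.
under eq_bigr => x _ do rewrite mnm1E.
have [->|nb] := eqVneq b b0.
  rewrite (bigD1 (mxvec_index b0 a)) ?block_mxvec_index //= eqxx big1 ?addn0 // => x.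
  by move=> /andP[_ /negbTE]; rewrite eq_sym => ->.
apply: big1 => x /eqP bx; apply/eqP; rewrite eqb0; apply: contraNneq nb => xE.
by rewrite -bx -xE block_mxvec_index.
Qed.

Lemma block_weightM (F : fieldType) (m N : nat) (beta beta' : 'I_m -> nat)
    (P Q : {mpoly F[m * N]}) :
  has_block_weight beta P -> has_block_weight beta' Q ->
  has_block_weight (fun b => beta b + beta' b)%N (P * Q).
Proof.
move=> hP hQ mon /msuppM_le /allpairsP[[m1 m2] /= [/hP h1 /hQ h2 ->]] b.
by rewrite -h1 -h2 -big_split; apply: eq_bigr => x _; rewrite mnmDE.
Qed.

Lemma block_weight_sum (F : fieldType) (m N : nat) (beta : 'I_m -> nat)
    (I : finType) (P : I -> {mpoly F[m * N]}) :
  (forall i, has_block_weight beta (P i)) -> has_block_weight beta (\sum_i P i).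
Proof.
move=> hP; elim/big_ind: _ => // [|p q hp hq] mon; first by rewrite msupp0.
by move=> /msuppD_le; rewrite mem_cat => /orP[/hp|/hq].
Qed.

Lemma block_weight_prod (F : fieldType) (m N : nat) (I : finType)
    (beta : I -> 'I_m -> nat) (P : I -> {mpoly F[m * N]}) :
  (forall i, has_block_weight (beta i) (P i)) ->
  has_block_weight (fun b => \sum_i beta i b)%N (\prod_i P i).
Proof.
move=> hP; elim: (index_enum I) => [|i r IH].
  rewrite big_nil; apply: eq_block_weight (@block_weight1 _ _ _) => b.
  by rewrite big_nil.
rewrite big_cons; apply: eq_block_weight (block_weightM (hP i) IH) => b.
by rewrite big_cons.
Qed.

Lemma msize_set_multilinear (F : fieldType) (k m : nat) (part : 'I_k -> 'I_m)
    (P : {mpoly F[k]}) :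
  set_multilinear part P -> P != 0 -> msize P = m.+1.
Proof.
move=> sm P0; rewrite -mlead_deg //; congr _.+1.
rewrite mdegE (partition_big part xpredT) //=.
under eq_bigr => b _ do rewrite sm ?mlead_supp //.
by rewrite sum1_card card_ord.
Qed.

(** The positions listed with [Y] first; the list has length [b], so the default is never reached.
    When [Y] has size [h] and [b = h + h], pairing slot [e] with slot [h + e] matches [Y] with its
    complement. *)
Definition arrange (b : nat) (Y : {set 'I_b}) (p : 'I_b) : 'I_b :=
  nth p (enum Y ++ enum (~: Y)) p.

Lemma size_arrange (b : nat) (Y : {set 'I_b}) :
  size (enum Y ++ enum (~: Y)) = b.
Proof. by rewrite size_cat -!cardE cardsC card_ord. Qed.

Lemma arrange_inj (b : nat) (Y : {set 'I_b}) : injective (arrange Y).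
Proof.
move=> p q; rewrite /arrange (set_nth_default p q) ?size_arrange // => /eqP.
rewrite nth_uniq ?size_arrange // => [/eqP/val_inj //|].
rewrite cat_uniq !enum_uniq andbT /=; apply/hasPn => x.
by rewrite !mem_enum inE.
Qed.

Lemma mem_arrange (b : nat) (Y : {set 'I_b}) (p : 'I_b) :
  (arrange Y p \in Y) = (p < #|Y|)%N.
Proof.
rewrite /arrange nth_cat -cardE; case: ltnP => [ltp|lep].
  by rewrite -mem_enum mem_nth // -cardE.
apply/negbTE; rewrite -in_setC -mem_enum mem_nth //.
by rewrite -(ltn_add2l #|Y|) subnKC // cardE -size_cat size_arrange.
Qed.

(** Block 0 of a group is reserved for the selector, hence the shift by [lift ord0]. *)
Definition pos_block (g b : nat) (j : 'I_g) (p : 'I_b) : 'I_(g * b.+1) :=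
  mxvec_index j (lift ord0 p).

Definition sel_block (g b : nat) (j : 'I_g) : 'I_(g * b.+1) := mxvec_index j ord0.

Definition inner_product (F : fieldType) (m N : nat) (b b' : 'I_m) :
    {mpoly F[m * N]} :=
  \sum_(a < N) 'X_(mxvec_index b a) * 'X_(mxvec_index b' a).

Definition gadget (F : fieldType) (g h N : nat) (Ys : 'I_N -> {set 'I_(h + h)})
    (j : 'I_g) : {mpoly F[g * (h + h).+1 * N]} :=
  \sum_(s < N) 'X_(mxvec_index (sel_block (h + h) j) s) *
    \prod_(e < h) inner_product F N (pos_block j (arrange (Ys s) (lshift h e)))
                                    (pos_block j (arrange (Ys s) (rshift h e))).

Definition hard_poly (F : fieldType) (g h N : nat) (Ys : 'I_N -> {set 'I_(h + h)}) :
    {mpoly F[g * (h + h).+1 * N]} :=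
  \prod_(j < g) gadget F Ys j.

(** [arrange] is a permutation for every [Y], balanced or not, so the two halves together use each
    position block exactly once in each summand. *)
Lemma gadget_weight (F : fieldType) (g h N : nat) (Ys : 'I_N -> {set 'I_(h + h)})
    (j : 'I_g) :
  has_block_weight (fun b => (\sum_(q < (h + h).+1) (b == mxvec_index j q))%N)
    (gadget F Ys j).
Proof.
apply: block_weight_sum => s.
pose lo e := pos_block j (arrange (Ys s) (lshift h e)).
pose hi e := pos_block j (arrange (Ys s) (rshift h e)).
have ip e : has_block_weight (fun b => (b == lo e) + (b == hi e))%N
    (inner_product F N (lo e) (hi e)).
  by apply: block_weight_sum => a; apply: block_weightM; exact: block_weightX.
apply: eq_block_weight
  (block_weightM (@block_weightX _ _ _ _ _) (block_weight_prod ip)) => b /=.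
rewrite big_ord_recl; congr (_ + _)%N.
rewrite (reindex_inj (@arrange_inj _ (Ys s))) big_split_ord /=.
by rewrite -big_split.
Qed.

Lemma hard_poly_set_multilinear (F : fieldType) (g h N : nat)
    (Ys : 'I_N -> {set 'I_(h + h)}) :
  set_multilinear (@block (g * (h + h).+1) N) (hard_poly F g Ys).
Proof.
suff W : has_block_weight (fun=> 1%N) (hard_poly F g Ys) by exact: W.
apply: eq_block_weight (block_weight_prod (@gadget_weight F g h N Ys)) => b /=.
case/mxvec_indexP: b => j0 q0.
rewrite (bigD1 j0) //= (bigD1 q0) //= eqxx !big1 ?addn0 // => [j nj|q nq].
  by apply: big1 => q _; rewrite mxvec_index_inj eq_sym (negbTE nj).
by rewrite mxvec_index_inj [q0 == q]eq_sym (negbTE nq) andbF.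
Qed.

Lemma meval_selection (F : fieldType) (m N : nat) (th : 'I_m -> 'I_N) b a :
  ('X_(mxvec_index b a) : {mpoly F[m * N]}).@[selection F th] = (th b == a)%:R.
Proof. by rewrite mevalXU /selection /block mx_coordK. Qed.

Lemma inner_product_selection (F : fieldType) (m N : nat) (th : 'I_m -> 'I_N) b b' :
  (inner_product F N b b').@[selection F th] = (th b == th b')%:R.
Proof.
rewrite rmorph_sum (bigD1 (th b)) //= big1 => [|a na].
  by rewrite addr0 rmorphM /= !meval_selection eqxx mul1r eq_sym.
by rewrite rmorphM /= !meval_selection eq_sym (negbTE na) mul0r.
Qed.

(** Each gadget keeps only the summand named by its selector, and an inner product becomes an
    equality test. *)
Lemma hard_poly_selection (F : fieldType) (g h N : nat)
    (Ys : 'I_N -> {set 'I_(h + h)}) (th : 'I_(g * (h + h).+1) -> 'I_N) :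
  (hard_poly F g Ys).@[selection F th] =
    [forall j : 'I_g, [forall e : 'I_h,
      let Y := Ys (th (sel_block (h + h) j)) in
      th (pos_block j (arrange Y (lshift h e))) ==
      th (pos_block j (arrange Y (rshift h e)))]]%:R.
Proof.
have prodE (I : finType) (c : pred I) : \prod_i (c i)%:R = [forall i, c i]%:R :> F.
  case: (boolP [forall i, c i]) => [/forallP call|/forallPn[i /negbTE nc]].
    by apply: big1 => i _; rewrite call.
  by rewrite (bigD1 i) //= nc mul0r.
rewrite rmorph_prod -prodE; apply: eq_bigr => j _ /=.
rewrite rmorph_sum (bigD1 (th (sel_block (h + h) j))) //= [X in _ + X]big1 => [|s ns].
  rewrite addr0 rmorphM /= meval_selection eqxx mul1r rmorph_prod -prodE.
  by apply: eq_bigr => e _; rewrite /= inner_product_selection.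
by rewrite rmorphM /= meval_selection eq_sym (negbTE ns) mul0r.
Qed.

Lemma hard_poly_neq0 (F : fieldType) (g h N : nat)
    (Ys : 'I_N.+1 -> {set 'I_(h + h)}) : hard_poly F g Ys != 0.
Proof.
apply/eqP => G0; have := @hard_poly_selection F g h _ Ys (fun=> ord0).
rewrite G0 meval0 (_ : [forall j, _] = true) => [/esym/eqP|].
  by rewrite oner_eq0.
by apply/forallP => j; apply/forallP => e.
Qed.

Lemma hard_poly_computes (F : fieldType) (g h N : nat)
    (Ys : 'I_N -> {set 'I_(h + h)}) :
  abp_computes (g * (1 + h * 2))
    (g * (N * (2 + (h * (N * 4 + 3) + 1)) + (1 + h * 2).+1) + 1) (hard_poly F g Ys).
Proof.
have cX m M (b : 'I_m) (a : 'I_M) :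
    abp_computes 1 2 ('X_(mxvec_index b a) : {mpoly F[m * M]}).
  by apply: abp_computes_linear; rewrite msizeX mdeg1.
apply: abp_computes_prod => j; apply: abp_computes_sum => // s.
apply: abp_computesM => //; apply: abp_computes_prod => e.
by apply: abp_computes_sum => // a; exact: abp_computesM (cX _ _ _ _) (cX _ _ _ _).
Qed.

(** * The lower bound *)

Definition group_set_of (g b : nat) (y : 'I_g -> {set 'I_b}) : {set 'I_g * 'I_b} :=
  [set p | p.2 \in y p.1].

Definition group_block (g b : nat) (p : 'I_g * 'I_b) : 'I_(g * b.+1) :=
  pos_block p.1 p.2.

Lemma group_block_inj (g b : nat) : injective (@group_block g b).
Proof.
move=> [j p] [j' p'] /eqP; rewrite mxvec_index_inj /= => /andP[/eqP-> /eqP].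
by move/lift_inj->.
Qed.

(** Applied with the left shift to [Y] and with the right shift to its complement, it turns the
    counts of early row and column blocks into the two sides of the imbalance of a prefix. *)
Lemma card_early_arrange (g h : nat) (sigma : 'S_(g * (h + h).+1))
    (y : 'I_g -> {set 'I_(h + h)}) (shift : 'I_h -> 'I_(h + h)) (l : nat)
    (Y : {set 'I_g * 'I_(h + h)}) :
  injective shift ->
  (forall j p, ((j, arrange (y j) p) \in Y) = (p \in codom shift)) ->
  #|early sigma (fun x => pos_block x.1 (arrange (y x.1) (shift x.2))) l| =
  #|early sigma (@group_block g (h + h)) l :&: Y|.
Proof.
move=> injs memY.
pose f (x : 'I_g * 'I_h) := (x.1, arrange (y x.1) (shift x.2)).
have injf : injective f by move=> [j e] [j' e'] [<- /arrange_inj/injs->].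
rewrite -(card_imset _ injf); apply: eq_card => -[j p]; rewrite !inE.
have [q qE] : exists q, p = arrange (y j) q.
  by have [a _ aK] := injF_bij (@arrange_inj _ (y j)); exists (a p).
rewrite qE memY; apply/imsetP/andP => [[[j' e]]|[lt /codomP[e qe]]].
  rewrite inE /= => lt [jE]; rewrite -jE => /arrange_inj ->.
  by rewrite codom_f /group_block /= jE.
by exists (j, e); rewrite ?inE /f /= -qe.
Qed.

(** Once the selectors are fixed to [s], the equality tests compare [u] and [v] at every matched
    pair, so the coefficient matrix is the identity. *)
Lemma hard_poly_spread (F : fieldType) (g h N : nat)
    (Ys : 'I_N.+1 -> {set 'I_(h + h)}) (s : 'I_g -> 'I_N.+1)
    (u v : {ffun 'I_g * 'I_h -> 'I_N.+1}) :
  let pos (shift : 'I_h -> 'I_(h + h)) (x : 'I_g * 'I_h) :=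
    pos_block x.1 (arrange (Ys (s x.1)) (shift x.2)) in
  (hard_poly F g Ys).@[selection F
     (spread (pos (lshift h)) (pos (@rshift h h)) (fun b => s (block b)) u v)] =
  (u == v)%:R.
Proof.
move=> pos.
have pos_eq sh sh' x x' : pos sh x = pos sh' x' -> x.1 = x'.1 /\ sh x.2 = sh' x'.2.
  move/eqP; rewrite mxvec_index_inj => /andP[/eqP j /eqP/lift_inj].
  by rewrite j => /arrange_inj.
rewrite hard_poly_selection; set th := spread _ _ _ _ _.
have th_sel j : th (sel_block (h + h) j) = s j.
  rewrite /th /spread; case: pickP => [e|_].
    by rewrite mxvec_index_inj andbF.
  case: pickP => [e|_]; first by rewrite mxvec_index_inj andbF.
  by rewrite block_mxvec_index.
have th_row x : th (pos (lshift h) x) = u x.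
  rewrite /th /spread; case: pickP => [x' /eqP/pos_eq[]|/(_ x)]; last by rewrite eqxx.
  by case: x x' => [j e] [j' e'] /= -> /lshift_inj->.
have th_col x : th (pos (@rshift h h) x) = v x.
  rewrite /th /spread; case: pickP => [x' /eqP/pos_eq[_ /eqP]|_].
    by rewrite eq_lrshift.
  case: pickP => [x' /eqP/pos_eq[]|/(_ x)]; last by rewrite eqxx.
  by case: x x' => [j e] [j' e'] /= -> /rshift_inj->.
congr (nat_of_bool _)%:R; apply/forallP/eqP => [uv|uv j].
  apply/ffunP => -[j e]; have /forallP/(_ e) := uv j.
  by rewrite /= th_sel (th_row (j, e)) (th_col (j, e)) => /eqP.
apply/forallP => e; rewrite /= th_sel.
by rewrite (th_row (j, e)) (th_col (j, e)) uv.
Qed.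

(** The identity has rank [N.+1 ^ (g * h)], each program contributes at most its width times
    [N.+1 ^ (g * h - K)], and rank is subadditive. *)
Lemma total_width_lower_bound (F : fieldType) (g h N K r : nat)
    (Ys : 'I_N.+1 -> {set 'I_(h + h)}) (s : 'I_g -> 'I_N.+1)
    (sigma : 'I_r -> 'S_(g * (h + h).+1)) (w : 'I_r -> nat -> nat)
    (lab : 'I_r -> nat -> nat -> nat -> {mpoly F[g * (h + h).+1 * N.+1]}) :
  let Y := group_set_of (fun j => Ys (s j)) in
  (forall j, #|Ys (s j)| = h) ->
  (forall i, smABP (@block _ N.+1) (sigma i) (w i) (lab i)) ->
  \sum_(i < r) abp_value (w i) (lab i) (g * (h + h).+1)%N = hard_poly F g Ys ->
  (forall i, exists l : 'I_(g * (h + h).+1).+1,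
     let pre := early (sigma i) (@group_block g (h + h)) l in
     (#|pre :&: Y| + K <= #|pre :\: Y|)%N \/ (#|pre :\: Y| + K <= #|pre :&: Y|)%N) ->
  (N.+1 ^ K <= \sum_(i < r) abp_width (w i) (g * (h + h).+1))%N.
Proof.
move=> Y cardY smA sumA disc.
pose E : finType := ('I_g * 'I_h)%type.
pose pos (shift : 'I_h -> 'I_(h + h)) (x : E) :=
  pos_block x.1 (arrange (Ys (s x.1)) (shift x.2)).
pose th := spread (pos (lshift h)) (pos (@rshift h h)) (fun b => s (block b)).
pose S : finType := {ffun E -> 'I_N.+1}.
pose M i (u v : S) :=
  (abp_value (w i) (lab i) (g * (h + h).+1)%N).@[selection F (th u v)].
have memY j p : ((j, arrange (Ys (s j)) p) \in Y) = (p < h)%N.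
  by rewrite inE /= mem_arrange cardY.
have codom_l p : (p \in codom (lshift h : 'I_h -> 'I_(h + h))) = (p < h)%N.
  apply/codomP/idP => [[e ->]|ltp]; first exact: (ltn_ord e).
  by exists (Ordinal ltp); apply: val_inj.
have codom_r p : (p \in codom (@rshift h h)) = ~~ (p < h)%N.
  apply/codomP/idP => [[e ->]|]; first by rewrite -leqNgt leq_addr.
  rewrite -leqNgt => lep; have ltp : (p - h < h)%N by rewrite ltn_subLR.
  by exists (Ordinal ltp); apply: val_inj; rewrite /= subnKC.
have cardE : #|S| = (N.+1 ^ #|E|)%N by rewrite card_ffun card_ord.
have rankM i : (\rank (kernel_mx (M i)) * N.+1 ^ K <=
    abp_width (w i) (g * (h + h).+1) * N.+1 ^ #|E|)%N.
  have [l] := disc i; set pre := early _ _ _ => imb.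
  have [] := smABP_rank_cut (pos (lshift h)) (pos (@rshift h h))
    (fun b => s (block b)) l (smA i).
  set B := early _ _ _; set A := early _ _ _ => le1 le2.
  have cA : #|A| = #|pre :&: Y|.
    apply: (@card_early_arrange g h _ (fun j => Ys (s j))) => [|j p].
      exact: lshift_inj.
    by rewrite memY codom_l.
  have cB : #|B| = #|pre :\: Y|.
    rewrite setDE; apply: (@card_early_arrange g h _ (fun j => Ys (s j))) => [|j p].
      exact: rshift_inj.
    by rewrite inE memY codom_r.
  have wl : (w i l <= abp_width (w i) (g * (h + h).+1))%N.
    by rewrite /abp_width (leq_bigmax (F := fun l : 'I__ => w i l)).
  have [cAC cBC] := (cardsC A, cardsC B).
  have conv e : (e + K <= #|E|)%N ->
      (\rank (kernel_mx (M i)) <= w i l * N.+1 ^ e)%N ->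
      (\rank (kernel_mx (M i)) * N.+1 ^ K <=
         abp_width (w i) (g * (h + h).+1) * N.+1 ^ #|E|)%N.
    move=> lee lerk; apply: leq_trans (leq_mul lerk (leqnn _)) _.
    by rewrite -mulnA -expnD leq_mul // leq_pexp2l.
  case: imb => imb; [apply: conv le2 | apply: conv le1];
    by move: imb; rewrite -cA -cB -?cAC -?cBC; lia.
have rk : (N.+1 ^ #|E| <= \sum_(i < r) \rank (kernel_mx (M i)))%N.
  apply: leq_trans (rank_kernel_sum M).
  rewrite (_ : kernel_mx _ = kernel_mx (fun u v : S => (u == v)%:R)).
    by rewrite rank_kernel1 cardE.
  apply/matrixP => i j; rewrite !mxE -(hard_poly_spread F Ys s) -sumA.
  by rewrite rmorph_sum.
have pos_exp : (0 < N.+1 ^ #|E|)%N by rewrite expn_gt0.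
rewrite -(leq_pmul2l pos_exp) mulnC.
apply: leq_trans (leq_mul (leqnn _) rk) _.
rewrite mulnC big_distrl mulnC big_distrl /=; apply: leq_sum => i _; exact: rankM.
Qed.

Lemma exists_discrepant (g h m r K T : nat)
    (lay : 'I_r -> 'I_g * 'I_(h + h) -> 'I_m) :
  (forall i, injective (lay i)) -> (T * K.*2 <= g * (h + h))%N ->
  (r * (2 ^ (g * (h + h)) * (2 ^ K.*2).-1 ^ T) < 'C(h + h, h) ^ g * (2 ^ K.*2) ^ T)%N ->
  exists y : 'I_g -> {set 'I_(h + h)}, (forall j, #|y j| = h) /\
    forall i, exists l : 'I_m.+1,
      let pre := prefix_set (lay i) l in let Y := group_set_of y in
      (#|pre :&: Y| + K <= #|pre :\: Y|)%N \/ (#|pre :\: Y| + K <= #|pre :&: Y|)%N.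
Proof.
move=> injl leT lt.
pose P : finType := ('I_g * 'I_(h + h))%type.
have cardP : #|P| = (g * (h + h))%N by rewrite card_prod !card_ord.
pose bad i := [set Y : {set P} | [forall l : 'I_m.+1,
        (#|prefix_set (lay i) l :\: Y| < #|prefix_set (lay i) l :&: Y| + K)%N &&
        (#|prefix_set (lay i) l :&: Y| < #|prefix_set (lay i) l :\: Y| + K)%N]].
have card_bad i : (#|bad i| * (2 ^ K.*2) ^ T <=
    2 ^ (g * (h + h)) * (2 ^ K.*2).-1 ^ T)%N.
  by rewrite -cardP; apply: card_low_discrepancy => //; rewrite cardP.
pose R := [set A : {set 'I_(h + h)} | #|A| == h].
pose bal := [set y : {ffun 'I_g -> {set 'I_(h + h)}} | y \in ffun_on (mem R)].
have card_bal : #|bal| = ('C(h + h, h) ^ g)%N.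
  by rewrite cardsE card_ffun_on card_draws !card_ord.
pose f (y : {ffun 'I_g -> {set 'I_(h + h)}}) : {set P} := group_set_of y.
have injf : injective f.
  move=> y y' /setP eqy; apply/ffunP => j; apply/setP => p.
  by have := eqy (j, p); rewrite !inE.
have [/subsetP sub|] := boolP (f @: bal \subset \bigcup_i bad i); last first.
  move/subsetPn => [_ /imsetP[y ybal ->] good]; exists y; split=> [j|i].
    by move: ybal; rewrite inE => /ffun_onP/(_ j); rewrite inE => /eqP.
  have : f y \notin bad i by apply: contra good => yi; apply/bigcupP; exists i.
  rewrite inE => /forallPn[l]; rewrite negb_and -!leqNgt => /orP disc.
  by exists l; case: disc; [left | right].
have : (#|bal| * (2 ^ K.*2) ^ T <= r * (2 ^ (g * (h + h)) * (2 ^ K.*2).-1 ^ T))%N.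
  rewrite -(card_imset _ injf).
  have le : (#|f @: bal| <= \sum_i #|bad i|)%N.
    apply: (@leq_trans #|\bigcup_i bad i|); first exact/subset_leq_card/subsetP.
    elim/big_rec2: _ => [|i n B _ IH]; first by rewrite cards0.
    by apply: leq_trans (leq_card_setU _ _).1 _; rewrite leq_add2l.
  apply: leq_trans (leq_mul le (leqnn _)) _; rewrite big_distrl /=.
  rewrite -[X in (_ <= X * _)%N]card_ord -sum_nat_const.
  by apply: leq_sum => i _; exact: card_bad.
by rewrite card_bal leqNgt lt.
Qed.

(** * Binomial and exponential estimates *)

Lemma central_binomial_lower_bound (h : nat) :
  (2 ^ (h + h) <= (h + h).+1 * 'C(h + h, h))%N.
Proof.
elim: h => // h IH.
(* Together these give [(h+1) C(2h+2, h+1) = 2 (2h+1) C(2h, h)]. *)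
have e1 := mul_bin_diag (h.+1 + h.+1) h.
have e2 := mul_bin_down (h.+1 + h) h.
rewrite -(leq_pmul2l (ltn0Sn h)).
move: e1 e2; rewrite !addSn !addnS /= !expnS.
move: IH; set x := 'C(_, _); set y := 'C(_, _); set z := 'C(_, _).
have -> : ((h + h).+1 - h = h.+1)%N by lia.
nia.
Qed.

(** Bernoulli's inequality for [(1 + 1/q)^(q+1)]. With [q.+1 = 2 ^ K.*2], avoiding that many chunks
    of [K.*2] positions at least halves the density. *)
Lemma double_expn_leq (q : nat) : (2 * q ^ q.+1 <= q.+1 ^ q.+1)%N.
Proof.
have bern n : (q ^ n.+1 + n.+1 * q ^ n <= q.+1 ^ n.+1)%N.
  elim: n => [|n IH]; first by rewrite !expn1 expn0 muln1 addn1.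
  rewrite [leqRHS]expnS; apply: leq_trans (leq_mul (leqnn _) IH).
  by rewrite !expnS; nia.
by apply: leq_trans (bern q); rewrite expnS; nia.
Qed.

(** * Choice of the parameters *)

Lemma leq_expn2r (a b e : nat) : (a <= b)%N -> (a ^ e <= b ^ e)%N.
Proof. by case: e => // e; rewrite leq_exp2r. Qed.

(** Balanced choices have density at least [(2h+1)^(-g)], sets avoiding [2 ^ K.*2 * T] chunks
    density at most [2^(-T)]; the hypothesis compares the two. *)
Lemma balanced_outnumber (g h K T r : nat) : (0 < K)%N ->
  (r * (h + h).+1 ^ g < 2 ^ T)%N ->
  (r * (2 ^ (g * (h + h)) * (2 ^ K.*2).-1 ^ (2 ^ K.*2 * T)) <
     'C(h + h, h) ^ g * (2 ^ K.*2) ^ (2 ^ K.*2 * T))%N.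
Proof.
move=> K0 lt.
have Q2 : (2 <= 2 ^ K.*2)%N by rewrite -{1}(expn1 2) leq_exp2l // double_gt0.
case: (2 ^ K.*2)%N Q2 => // q q0 /=.
have C0 : (0 < 'C(h + h, h) ^ g)%N by rewrite expn_gt0 bin_gt0 leq_addl.
have q0T : (0 < q ^ (q.+1 * T))%N by rewrite expn_gt0 -ltnS q0.
have leC : (2 ^ (g * (h + h)) <= (h + h).+1 ^ g * 'C(h + h, h) ^ g)%N.
  by rewrite mulnC expnM -expnMn leq_expn2r // central_binomial_lower_bound.
have leq : (2 ^ T * q ^ (q.+1 * T) <= q.+1 ^ (q.+1 * T))%N.
  by rewrite !expnM -expnMn; apply: leq_expn2r; exact: double_expn_leq.
apply: (@leq_trans ('C(h + h, h) ^ g * (2 ^ T * q ^ (q.+1 * T)))); last first.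
  by rewrite leq_mul2l leq orbT.
apply: (@leq_ltn_trans ('C(h + h, h) ^ g * (r * (h + h).+1 ^ g * q ^ (q.+1 * T)))).
  rewrite (_ : 'C(_, _) ^ g * _ =
    r * ((h + h).+1 ^ g * 'C(h + h, h) ^ g * q ^ (q.+1 * T)))%N; last by lia.
  by rewrite leq_mul2l leq_mul2r leC !orbT.
by rewrite ltn_pmul2l // ltn_pmul2r.
Qed.

(** For [v] about [b / (2M)] this yields [b.+1 <= 2 ^ v]: balancing a group of [b] positions costs
    only a small share of [b] in the exponent. *)
Lemma linear_leq_expn (M v : nat) : (8 * M <= v)%N -> (2 * M * v.+1 <= 2 ^ v)%N.
Proof.
move=> lev; have := odd_double_half v; set u := v./2 => vE.
have leu : (4 * M <= 2 ^ u)%N.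
  by apply: leq_trans (ltnW (ltn_expl u (ltnSn 1))); lia.
have ltu := ltn_expl u (ltnSn 1).
have : (2 ^ u * 2 ^ u <= 2 ^ v)%N by rewrite -expnD leq_exp2l // addnn; lia.
apply: leq_trans; apply: leq_trans (leq_mul leu ltu).
by rewrite (_ : 4 * M * u.+1 = 2 * M * (2 * u.+1))%N ?leq_mul2l; lia.
Qed.

(** A group has twice this many positions, so its subsets number at most [n.+1] and can be named by
    the selector variables. *)
Definition half_log (n : nat) : nat := (trunc_log 2 n)./2.

Definition num_groups (d : nat -> nat) (n : nat) : nat :=
  (d n %/ (half_log n + half_log n).+1)%N.

Lemma half_log_bounds (n : nat) :
  (half_log n + half_log n <= trunc_log 2 n <= half_log n + half_log n + 1)%N.
Proof. by rewrite /half_log addnn; have := odd_double_half (trunc_log 2 n); lia. Qed.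

Lemma expn_half_log (n : nat) : (2 ^ (half_log n + half_log n) <= n.+1)%N.
Proof.
have /andP[le _] := half_log_bounds n.
case: n le => [|n] le; first by rewrite /half_log trunc_log0.
apply: leq_trans (leqnSn _); apply: leq_trans (trunc_logP (ltnSn 1) (ltn0Sn n)).
by rewrite leq_exp2l.
Qed.

(** The term [v * g] takes at most half of [g * b / M]. The other half covers
    [c + lam.+1 * c + 1 <= (3 * c + 1) * lam], since [g * b] is about [d / 2] or more; the extra
    [lam] in the bound on [d] absorbs the incomplete last group. *)
Lemma exponent_bound (M b g v lam c d T : nat) :
  (0 < M)%N -> (0 < b)%N -> (0 < lam)%N -> (b <= lam)%N ->
  (2 * M * v <= b)%N -> (d < g.+1 * b.+1)%N ->
  ((1 + 4 * M * (3 * c + 1)) * lam <= d)%N -> (g * b < M * T.+1)%N ->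
  (c + lam.+1 * c + v * g < T)%N.
Proof.
move=> M0 b0 lam0 leb v_b; rewrite mulSn mulnS => gd led T_gb.
have vg : (2 * M * v * g <= g * b)%N by rewrite mulnC leq_mul2l v_b orbT.
have g_gb : (g <= g * b)%N by rewrite leq_pmulr.
have c_lam : (c <= c * lam)%N by rewrite leq_pmulr.
have in_lam : (c + lam.+1 * c + 1 <= (3 * c + 1) * lam)%N.
  by rewrite mulnDl mulSn; lia.
have le_d : (lam + 4 * M * (c + lam.+1 * c + 1) <= d)%N.
  by apply: leq_trans led; rewrite mulnDl mul1n leq_add2l -[leqRHS]mulnA leq_mul.
rewrite -ltnS -(ltn_pmul2l M0); apply: leq_ltn_trans T_gb.
rewrite -addnS addnC addSn -addnS -[(c + _).+1]addn1 mulnDr.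
move: le_d vg; move: (c + lam.+1 * c + 1)%N => X; rewrite -!mulnA.
by move: (g * b)%N (M * X)%N (M * (v * g))%N gd g_gb => gb MX Mvg; lia.
Qed.

Lemma eventually_many_balanced (d : nat -> nat)
    (hlog : forall C : nat, exists N : nat, forall n, (N <= n)%N ->
            (C * trunc_log 2 n <= d n)%N) (c K : nat) : (0 < K)%N ->
  exists n0, forall n, (n0 <= n)%N ->
    let h := half_log n in let g := num_groups d n in
    exists T, (T * K.*2 <= g * (h + h))%N /\
      (c * n.+1 ^ c * (2 ^ (g * (h + h)) * (2 ^ K.*2).-1 ^ T) <
         'C(h + h, h) ^ g * (2 ^ K.*2) ^ T)%N.
Proof.
(* Each factor of two uses [2 ^ K.*2] chunks of [K.*2] positions, that is [M] positions. *)
move=> K0; pose M := (K.*2 * 2 ^ K.*2)%N.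
have M0 : (0 < M)%N by rewrite muln_gt0 double_gt0 K0 expn_gt0.
have [n1 hn1] := hlog (1 + 4 * M * (3 * c + 1))%N.
(* The threshold forces [b >= 16 * M * M], hence [v >= 8 * M], as [linear_leq_expn] requires. *)
exists (maxn n1 (2 ^ (16 * M * M + 2))) => n; rewrite geq_max => /andP[/hn1 led].
move=> /(trunc_log_max (ltnSn 1)) leL h g.
have /andP[] := half_log_bounds n; rewrite -/h; set b := (h + h)%N => leb geb.
set lam := trunc_log 2 n in led leL leb geb.
pose v := (b %/ (2 * M))%N.
have ltb : (b < 2 * M * v.+1)%N by rewrite [ltnRHS]mulnC ltn_ceil // muln_gt0.
have lev : (8 * M <= v)%N by rewrite leq_divRL ?muln_gt0 //; nia.
have b_v : (b.+1 <= 2 ^ v)%N := leq_trans ltb (linear_leq_expn lev).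
have v_b : (2 * M * v <= b)%N by rewrite mulnC leq_divM.
have gd : (d n < g.+1 * b.+1)%N by exact: ltn_ceil.
pose T := (g * b %/ M)%N.
have T_gb : (g * b < M * T.+1)%N by rewrite [ltnRHS]mulnC ltn_ceil.
have b0 : (0 < b)%N by lia.
have many : (c + lam.+1 * c + v * g < T)%N.
  by apply: (@exponent_bound M b g v lam c (d n)) => //; lia.
exists (2 ^ K.*2 * T)%N; split.
  rewrite mulnAC [(2 ^ _ * _)%N]mulnC mulnC -/M; exact: leq_divM.
apply: balanced_outnumber => //.
have ltn : (n.+1 <= 2 ^ lam.+1)%N by apply: trunc_log_ltn.
have lec : (c * n.+1 ^ c <= 2 ^ (c + lam.+1 * c))%N.
  rewrite expnD expnM leq_mul ?leq_expn2r //; exact/ltnW/ltn_expl.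
apply: (@leq_ltn_trans (2 ^ (c + lam.+1 * c) * 2 ^ (v * g))%N).
  by rewrite leq_mul // expnM leq_expn2r.
by rewrite -expnD ltn_exp2l.
Qed.

(** Selectors beyond the number of subsets name the empty set; the polynomial stays set-multilinear
    for any family of sets. *)
Definition nth_set (b N : nat) (s : 'I_N) : {set 'I_b} :=
  nth set0 (enum {: {set 'I_b}}) s.

Lemma nth_set_surj (b N : nat) (Y : {set 'I_b}) : (2 ^ b <= N)%N ->
  exists s : 'I_N, nth_set b s = Y.
Proof.
move=> leN; have lts : (index Y (enum {: {set 'I_b}}) < N)%N.
  apply: leq_trans leN; rewrite -[b in (2 ^ b)%N]card_ord -cardsT -card_powerset.
  rewrite powersetT cardsT cardE index_mem.
  by rewrite mem_enum.
by exists (Ordinal lts); rewrite /nth_set nth_index // mem_enum.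
Qed.

(** The total width thus bounds the number of orders entering the union bound. *)
Lemma sum_width_ge (r : nat) (w : 'I_r -> nat -> nat) (m : nat) :
  (forall i, w i 0%N = 1%N) -> (r <= \sum_(i < r) abp_width (w i) m)%N.
Proof.
move=> w0; rewrite -[leqLHS]card_ord -sum1_card; apply: leq_sum => i _.
by rewrite -(w0 i) /abp_width (leq_bigmax (F := fun l : 'I_m.+1 => w i l) ord0).
Qed.

Local Close Scope ring_scope.

Theorem theorem1p3 (F : fieldType) (d : nat -> nat)
  (hdn : forall n, (d n <= n)%N)
  (hlog : forall C : nat, exists N : nat, forall n, (N <= n)%N ->
            (C * trunc_log 2 n <= d n)%N) :
  exists (k m : nat -> nat) (part : forall n, 'I_(k n) -> 'I_(m n))
         (G : forall n, {mpoly F[k n]}),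
    [/\ big_Theta k (fun n => d n * n)%N,
        big_Theta (fun n => (msize (G n)).-1) d,
        (exists N, forall n, (N <= n)%N ->
           [/\ is_partition (part n), G n != 0%R & set_multilinear (part n) (G n)]),
        in_VBP G
      & forall (c N : nat), exists n, (N <= n)%N /\
          ~ sum_smABP_total_width_le (part n) (G n) (c * n.+1 ^ c)].
Proof.
pose h := half_log; pose g := num_groups d.
pose m n := (g n * (h n + h n).+1)%N.
pose G n : {mpoly F[m n * n.+1]} :=
  hard_poly F (g n) (fun s : 'I_n.+1 => nth_set (h n + h n) s).
have sizeG n : (msize (G n)).-1 = m n.
  by rewrite (msize_set_multilinear (@hard_poly_set_multilinear _ _ _ _ _))
    ?hard_poly_neq0.
have m_le n : (m n <= d n)%N by exact: leq_divM.
have [n2 d_le] : exists n2, forall n, (n2 <= n)%N -> (d n <= 2 * m n)%N.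
  (* The constant 2 ensures [2h + 1 <= d n], so there is at least one group and rounding down to
     whole groups loses at most half of [d n]. *)
  have [n1 hn1] := hlog 2; exists (maxn n1 2) => n.
  rewrite geq_max => /andP[/hn1 led n2].
  have := @trunc_log_max 2 n 1 (ltnSn 1) n2; have /andP[leb _] := half_log_bounds n => lam1.
  have b_d : ((h n + h n).+1 <= d n)%N by rewrite -/(h n) in leb; lia.
  have g0 : (0 < g n)%N by rewrite divn_gt0.
  have : (d n < (g n).+1 * (h n + h n).+1)%N by exact: ltn_ceil.
  by rewrite /m; nia.
exists (fun n => m n * n.+1)%N, m, (fun n => @block (m n) n.+1), G; split.
- exists 2%N, (maxn n2 1) => n; rewrite geq_max => /andP[/d_le led n1].
  by have := m_le n; nia.
- by exists 2%N, n2 => n /d_le led; rewrite sizeG; have := m_le n; lia.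
- exists 0%N => n _; split; [|exact: hard_poly_neq0|exact: hard_poly_set_multilinear].
  by move=> b; exists (mxvec_index b ord0); rewrite block_mxvec_index.
(* One number serves as coefficient and exponent; with [N = n.+1] the size is at most
   [15 * N ^ 4]. *)
- exists 17%N => n; rewrite sizeG; have m_n := leq_trans (m_le n) (hdn n).
  have pow4 : (n.+1 * (n.+1 * (n.+1 * n.+1)) <= n.+1 ^ 17)%N.
    by rewrite -(expn1 n.+1) -!expnD leq_pexp2l.
  split; first by nia.
  have [w [lab [sh [sz [val le]]]]] :=
    hard_poly_computes F (g n) (fun s : 'I_n.+1 => nth_set (h n + h n) s).
  exists (g n * (1 + h n * 2))%N, w, lab; do 3!split => //.
  apply: leq_trans le _.
  have g_n : (g n <= n)%N by apply: leq_trans (leq_div _ _) (hdn n).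
  have h_n : (h n <= n)%N.
    have /andP[leb _] := half_log_bounds n; rewrite -/(h n) in leb.
    have := leq_trans (ltn_expl _ (ltnSn 1)) (expn_half_log n).
    by rewrite -/(h n); lia.
  set N := n.+1 in pow4 *.
  apply: (@leq_trans (N * (N * (2 + (N * (N * 4 + 3) + 1)) + (1 + N * 2).+1) + 1)%N).
    rewrite leq_add2r leq_mul ?(leq_trans g_n) // leq_add // ?leq_mul //; nia.
  nia.
(* Imbalance [c.+1] forces total width at least [n.+1 ^ c.+1], which exceeds [c * n.+1 ^ c] once
   [n >= c]. *)
move=> c N0; have [n0 hn0] := eventually_many_balanced hlog c (ltn0Sn c).
pose n := maxn (maxn n0 N0) c; exists n; split; first by rewrite /n; lia.
move=> [r [sigma [w [lab [smA [sumA width]]]]]].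
have [|T [leT lt]] := hn0 n; first by rewrite /n; lia.
pose lay i (p : 'I_(g n) * 'I_(h n + h n)) := ((sigma i)^-1)%g (group_block p).
have injl i : injective (lay i) by move=> p q /perm_inj/group_block_inj.
have r_le : (r <= c * n.+1 ^ c)%N.
  by apply: leq_trans width; apply: sum_width_ge => i; have [[]] := smA i.
have [|y [cy disc]] := exists_discrepant injl leT.
  by apply: leq_ltn_trans lt; rewrite leq_mul2r r_le orbT.
have [s sE] := fin_all_exists (fun j => nth_set_surj (y j) (expn_half_log n)).
have cs j : #|nth_set (h n + h n) (s j)| = h n by rewrite sE.
have eqY : group_set_of (fun j => nth_set (h n + h n) (s j)) = group_set_of y.
  by apply/setP => p; rewrite !inE sE.
have := total_width_lower_bound cs smA sumA; rewrite eqY => /(_ c.+1 disc).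
rewrite leqNgt (leq_ltn_trans width) // expnS ltn_pmul2r ?expn_gt0 //.
by rewrite /n; lia.
Qed.
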